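(* Let $T_n$ be the Tribonacci numbers defined by $T_1=1$, $T_2=1$, $T_3=2$, and $T_{n+3}=T_{n+2}+T_{n+1}+T_n$ for $n\ge 1$. Then for every $n\ge 1$, $$T_n=\sum_{k=1}^n\sum_{i=0}^k\sum_{j=i}^{n-k}\binom{k}{i}\binom{j-1}{i-1}\binom{j}{n-k-2j}.$$
   Context: Conventions for binomial coefficients: $\binom{-1}{-1}=1$; $\binom{r}{s}=0$ if $r\ge 0$ and ($s<0$ or $s>r$). Sums whose upper limit is smaller than the lower limit are $0$. *)

(* Defs.v *)
From mathcomp Require Import all_boot all_order all_algebra.

Set Implicit Arguments.
Unset Strict Implicit.
Unset Printing Implicit Defensive.

Import GRing.Theory.
Local Open Scope ring_scope.

(* The sequence starts at index 1; the value at 0 is a placeholder. *)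
Fixpoint tribonacci (n : nat) : nat :=
  match n with
  | 0 => 0
  | 1 => 1
  | 2 => 1
  | 3 => 2
  | ((((_.+1) as p1).+1 as p2).+1 as p3).+1 =>
      (tribonacci p3 + tribonacci p2 + tribonacci p1)%N
  end%N.

(* Binomial coefficient with integer arguments: binom(-1, -1) = 1, and
   binom(r, s) = 0 when r >= 0 and (s < 0 or s > r).  The remaining
   arguments with r < 0 are given the value 0 arbitrarily. *)
Definition binz (r s : int) : nat :=
  match r, s with
  | Posz m, Posz k => 'C(m, k)
  | Negz 0, Negz 0 => 1%N
  | _, _ => 0%N
  end.

(* Main.v *)
Require Import Defs.
From mathcomp Require Import all_boot all_order all_algebra.
From mathcomp Require Import zify.

Set Implicit Arguments.
Unset Strict Implicit.
Unset Printing Implicit Defensive.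

Import GRing.Theory.
Local Open Scope ring_scope.

(** Write n = m + 1. Both sides count the compositions of m into parts 1, 2
    and 3. A composition with p parts contributes 1 to the coefficient of X^m in
    (X + X^2 + X^3)^p, so T_(m+1) is the sum of these coefficients over p
    (tribonacci_sum_coef, by the Tribonacci recurrence).

    Expanding (X + X^2 (1 + X))^p instead, where j counts the parts that
    exceed 1, gives the coefficient as the sum over j of
    C(p, j) C(j, m - p - j) (coef_step_polyX). In the triple sum, the sum over
    i is a Vandermonde convolution equal to C(k - 1 + j, j) (sum_bin_binz), so
    k - 1 is the number of parts equal to 1. The substitution p = k - 1 + j
    (sum_triangle) identifies the two double sums. *)

(** The factored form X^2 (1 + X) separates the parts equal to 1 from the
    others. *)
Definition step_poly : {poly nat} := 'X + 'X^2 * (1 + 'X).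

Lemma coef_step_polyM (q : {poly nat}) (m : nat) :
  (step_poly * q)`_m =
    ((if m < 1 then 0 else (q`_(m - 1)%N)%R) + (if m < 2 then 0 else (q`_(m - 2)%N)%R)
     + (if m < 3 then 0 else (q`_(m - 3)%N)%R))%N.
Proof.
have -> : step_poly = 'X^1 + 'X^2 + 'X^3.
  by rewrite /step_poly mulrDr mulr1 -exprSr addrA.
by rewrite !mulrDl !coefD !coefXnM.
Qed.

(** Removing one factor from each positive power turns the sum at m into the
    sums at m - 1, m - 2 and m - 3, which is the Tribonacci recurrence. Allowing
    any bound N > m, rather than N = m + 1 only, lets the induction hypothesis
    apply to all three with the same bound N - 1. *)
Lemma tribonacci_sum_coef (N m : nat) : (m < N)%N ->
  (\sum_(p < N) ((step_poly ^+ p)`_m)%R)%N = tribonacci m.+1.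
Proof.
elim/ltn_ind: m N => m IHm [//|N] ltmN.
rewrite big_ord_recl expr0 coef1.
under eq_bigr => p _ do rewrite lift0 exprS coef_step_polyM.
case: m IHm ltmN => [|[|[|m]]] IHm ltmN /=; rewrite !big_split /= ?subSS ?subn0;
  rewrite ?(big1_eq, sum_nat_const, muln0) ?IHm //; lia.
Qed.

Lemma coef_expr1X (j l : nat) : ((1 + 'X : {poly nat}) ^+ j)`_l = 'C(j, l).
Proof.
have -> : (1 + 'X : {poly nat}) ^+ j = \poly_(i < j.+1) 'C(j, i).
  rewrite exprDn poly_def; apply: eq_bigr => i _.
  by rewrite expr1n mul1r -scaler_nat natn.
by rewrite coef_poly ltnS; case: leqP => // ltjl; rewrite bin_small.
Qed.

(** Binomial expansion of (X + X^2 (1 + X))^p: choosing the second summand j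
    times yields X^(p + j) (1 + X)^j. The guard replaces truncated
    subtraction, which would give the value 1 when p + j exceeds m. *)
Lemma coef_step_polyX (p m : nat) :
  (step_poly ^+ p)`_m =
    (\sum_(0 <= j < p.+1)
       'C(p, j) * (if p + j <= m then 'C(j, m - (p + j)) else 0))%N.
Proof.
rewrite exprDn coef_sum big_mkord; apply: eq_bigr => j _.
rewrite exprMn -exprM mulrA -exprD coefMn coefXnM coef_expr1X.
have lejp : (j <= p)%N by rewrite -ltnS.
have -> : (p - j + 2 * j = p + j)%N by lia.
rewrite ltnNge; case: (p + j <= m)%N; rewrite ?mul0rn ?muln0 //=.
by rewrite mulnC -mulr_natr natn.
Qed.

(** The substitution p = a + j over the triangle j <= p < N. Enlarging N adds
    the antidiagonal a + j = N on the left and the row p = N on the right, which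
    agree after reversing the order of summation. *)
Lemma sum_triangle (N : nat) (F : nat -> nat -> nat) :
  (\sum_(0 <= a < N) \sum_(0 <= j < N - a) F (a + j) j =
   \sum_(0 <= p < N) \sum_(0 <= j < p.+1) F p j)%N.
Proof.
elim: N => [|N IHN]; first by rewrite !big_nil.
rewrite [RHS]big_nat_recr // -IHN [LHS]big_nat_recr //= subSnn big_nat1 addn0.
(* Split off from each inner sum its last term, the one with a + j = N. *)
under eq_big_nat => a /andP[_ ltaN].
  rewrite subSn ?(ltnW ltaN) // big_nat_recr //= subnKC ?(ltnW ltaN) //.
  over.
rewrite big_split /= -addnA; congr addn.
rewrite [RHS]big_nat_rev /= [RHS]big_nat_recr //= add0n subSS subnn.
by congr addn; apply: eq_big_nat => a _; rewrite add0n subSS.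
Qed.

(** For j > 0 the term i = 0 vanishes and C(k+1, i) = C(k+1, k+1-i) turns the
    rest into a Vandermonde convolution. For j = 0 the convention
    binom(-1, -1) = 1 makes i = 0 the only nonzero term. *)
Lemma sum_bin_binz (k j : nat) :
  (\sum_(0 <= i < k.+2) 'C(k.+1, i) * binz (j%:Z - 1) (i%:Z - 1) =
   'C(k + j, j))%N.
Proof.
rewrite big_nat_recl // bin0 mul1n.
case: j => [|j].
  by rewrite big1 ?addn0 ?bin0 // => i _; rewrite intS [X in binz _ X]addrC addKr muln0.
rewrite intS addrC addKr add0n.
under eq_big_nat => i /andP[_ ltik].
  rewrite intS addrC addKr -bin_sub // subSS mulnC /=; over.
rewrite big_mkord binomial.Vandermonde -[RHS]bin_sub ?leq_addl //.
by rewrite addnK addnC addSnnS.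
Qed.

Lemma binz_small (i j : nat) : (j < i)%N -> binz (j%:Z - 1) (i%:Z - 1) = 0%N.
Proof.
case: i => [//|i]; rewrite intS [X in binz _ X]addrC addKr.
case: j => [//|j]; rewrite intS addrC addKr ltnS => /=; exact: bin_small.
Qed.

Lemma binz_subn (j m k : nat) :
  binz j%:Z (m%:Z - k%:Z) = if (k <= m)%N then 'C(j, m - k) else 0%N.
Proof.
case: leqP => [lekm|ltmk]; first by rewrite subzn.
by have -> : m%:Z - k%:Z = Negz (k - m).-1 by lia.
Qed.

Theorem mainTheorem20 (n : nat) (hn : (1 <= n)%N) :
  tribonacci n =
    (\sum_(1 <= k < n.+1) \sum_(0 <= i < k.+1) \sum_(i <= j < (n - k).+1)
       'C(k, i) * binz (j%:Z - 1)%R (i%:Z - 1)%R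
                * binz j%:Z (n%:Z - k%:Z - 2 * j%:Z)%R)%N.
Proof.
case: n hn => [//|m] _.
rewrite -(tribonacci_sum_coef (ltnSn m)).
rewrite -(big_mkord xpredT (fun p => (step_poly ^+ p)`_m)).
under eq_bigr => p _ do rewrite coef_step_polyX.
rewrite -(sum_triangle m.+1 (fun p j =>
  'C(p, j) * (if p + j <= m then 'C(j, m - (p + j)) else 0))%N).
rewrite [RHS]big_add1 /=; apply: eq_big_nat => k /andP[_ ltkm].
rewrite subSS -subSn //.
(* The terms with j < i vanish, so j may start at 0; its range is then
   independent of i and the two sums can be exchanged. *)
under [RHS]eq_bigr => i _.
  rewrite (big_nat_widenl _ 0) // big_mkcondr /=.
  under eq_bigr => j _.
    have -> : (if (i <= j)%N then 'C(k.+1, i) * binz (j%:Z - 1) (i%:Z - 1)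
                 * binz j%:Z (m.+1%:Z - k.+1%:Z - 2 * j%:Z) else 0)%N =
              ('C(k.+1, i) * binz (j%:Z - 1) (i%:Z - 1)
                 * binz j%:Z (m%:Z - (k + j + j)%N%:Z))%N.
      case: leqP => [_|ltji]; last by rewrite binz_small // muln0.
      by congr (_ * binz _ _)%N; lia.
    over.
  over.
rewrite exchange_big_nat; apply: eq_bigr => j _.
by rewrite -big_distrl sum_bin_binz binz_subn.
Qed.
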